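(* There exists a graph on six vertices such that the drawing produced by classical multidimensional scaling is not computable in a radical computation tree.
   Context: Classical multidimensional scaling of a connected graph $G$ on $n$ vertices into $d$ dimensions: let $D$ be the $n\times n$ matrix of squared graph-theoretic distances between vertices; double-center it to obtain $B=-\frac12 JDJ$ with $J=I-\frac1n\mathbf{1}\mathbf{1}^T$; factor $B=V\Lambda V^T$ with $V$ orthonormal eigenvectors sorted by eigenvalue (largest first) and $\Lambda$ the diagonal matrix of eigenvalues; the vertex positions are the rows of the first $d$ columns of $V\Lambda^{1/2}$ (here $d=2$, a planar drawing). An algebraic computation tree is a rooted tree whose computation nodes compute a value as the sum, difference, product or quotient of integer constants and values computed at ancestor nodes, and whose decision nodes test whether a computed value is greater than zero and branch. A radical computation tree additionally allows computing the $k$-th root of a previously computed value ($k$ an integer parameter) and complex conjugation. *)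

(* Defs.v *)
(* (+ mathcomp-real-closed's complex numbers R[i]). *)
From mathcomp Require Import all_boot all_algebra all_reals complex.
Set Implicit Arguments. Unset Strict Implicit. Unset Printing Implicit Defensive.
Import GRing.Theory Num.Theory.
Local Open Scope ring_scope.

(* ---------- Graphs ---------- *)
(* A simple undirected graph on the vertex set 'I_n, given by an adjacency
   relation e; simple_graph e says e is symmetric and irreflexive. *)
Definition simple_graph (n : nat) (e : rel 'I_n) : Prop :=
  (forall x y, e x y = e y x) /\ (forall x, ~~ e x x).

Definition connected_graph (n : nat) (e : rel 'I_n) : Prop :=
  forall x y, connect e x y.

(* walk_len e k x y : there is a walk with exactly k edges from x to y *)
Fixpoint walk_len (n : nat) (e : rel 'I_n) (k : nat) (x y : 'I_n) : bool :=
  match k with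
  | 0 => x == y
  | k'.+1 => [exists z, e x z && walk_len e k' z y]
  end.

(* graph-theoretic distance: least k such that a walk of length k exists
   (for connected graphs this is < n; the value n signals "unreachable") *)
Definition gdist (n : nat) (e : rel 'I_n) (x y : 'I_n) : nat :=
  find (fun k => walk_len e k x y) (iota 0 n).

(* ---------- Classical multidimensional scaling ---------- *)
Section CMDS.
Variable R : realType.

(* D = squared distance matrix *)
Definition sqdist_mx (n : nat) (e : rel 'I_n) : 'M[R]_n :=
  \matrix_(i, j) ((gdist e i j) ^ 2)%N%:R.

(* centering matrix J = I - (1/n) 1 1^T *)
Definition center_mx (n : nat) : 'M[R]_n :=
  1%:M - (n%:R)^-1 *: const_mx 1.

(* B = -1/2 J D J *)
Definition cmds_B (n : nat) (e : rel 'I_n) : 'M[R]_n :=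
  (- 2%:R^-1) *: (center_mx n *m sqdist_mx e *m center_mx n).

(* P : 'M_(n, d) is a (valid) classical-MDS drawing of the graph e in d
   dimensions: for some factorisation B = V Λ V^T with V orthonormal and the
   eigenvalues in Λ sorted in nonincreasing order, P consists of the first d
   columns of V Λ^{1/2}. *)
Definition cmds_drawing (n d : nat) (hd : (d <= n)%N) (e : rel 'I_n)
    (P : 'M[R]_(n, d)) : Prop :=
  exists (V : 'M[R]_n) (lam : 'I_n -> R),
    [/\ V^T *m V = 1%:M,
        cmds_B e = V *m diag_mx (\row_j lam j) *m V^T,
        (forall i j : 'I_n, (i <= j)%N -> lam j <= lam i) &
        P = \matrix_(i < n, c < d)
              (V i (widen_ord hd c) * Num.sqrt (lam (widen_ord hd c)))].
End CMDS.

(* ---------- Radical computation trees ---------- *)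
(* Values live in the complex numbers C = R[i].  Each computation node refers
   to previously computed values (inputs first, then the values computed at the
   ancestor nodes in order) by their index. *)
Inductive rop : Type :=
  | OpConst of int          (* integer constant *)
  | OpAdd of nat & nat
  | OpSub of nat & nat
  | OpMul of nat & nat
  | OpDiv of nat & nat
  | OpRoot of nat & nat      (* OpRoot k i : a k-th root of value i *)
  | OpConj of nat.           (* complex conjugate of value i *)

Inductive rtree : Type :=
  | RLeaf of seq nat                   (* output the listed values *)
  | RComp of rop & rtree               (* computation node *)
  | RTest of nat & rtree & rtree.      (* if value i > 0 then left else right *)

Section RadicalSemantics.
Variable R : realType.
Local Notation C := R[i].
Local Open Scope complex_scope.

(* rop_step env op v : executing op in environment env may yield v.
   Operand indices must refer to already computed values; division requires
   a nonzero divisor; k-th roots (k >= 1) may return any k-th root. *)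
Inductive rop_step (env : seq C) : rop -> C -> Prop :=
  | StConst z : rop_step env (OpConst z) (z%:~R)
  | StAdd i j : (i < size env)%N -> (j < size env)%N ->
      rop_step env (OpAdd i j) (nth 0 env i + nth 0 env j)
  | StSub i j : (i < size env)%N -> (j < size env)%N ->
      rop_step env (OpSub i j) (nth 0 env i - nth 0 env j)
  | StMul i j : (i < size env)%N -> (j < size env)%N ->
      rop_step env (OpMul i j) (nth 0 env i * nth 0 env j)
  | StDiv i j : (i < size env)%N -> (j < size env)%N -> nth 0 env j != 0 ->
      rop_step env (OpDiv i j) (nth 0 env i / nth 0 env j)
  | StRoot k i w : (0 < k)%N -> (i < size env)%N -> w ^+ k = nth 0 env i ->
      rop_step env (OpRoot k i) w
  | StConj i : (i < size env)%N ->
      rop_step env (OpConj i) ((nth 0 env i)^*).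

(* rtree_run env t out : running t from env can produce output out.
   Decision nodes test whether the value is > 0 (i.e. a positive real). *)
Inductive rtree_run : seq C -> rtree -> seq C -> Prop :=
  | RunLeaf env s : all (fun i => i < size env)%N s ->
      rtree_run env (RLeaf s) [seq nth 0 env i | i <- s]
  | RunComp env op v t out : rop_step env op v ->
      rtree_run (rcons env v) t out -> rtree_run env (RComp op t) out
  | RunPos env i t1 t2 out : (i < size env)%N -> 0 < nth 0 env i ->
      rtree_run env t1 out -> rtree_run env (RTest i t1 t2) out
  | RunNonPos env i t1 t2 out : (i < size env)%N -> ~~ (0 < nth 0 env i) ->
      rtree_run env t2 out -> rtree_run env (RTest i t1 t2) out.

(* input encoding of a graph: its adjacency matrix, row-major, as 0/1 values *)
Definition graph_input (n : nat) (e : rel 'I_n) : seq C :=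
  [seq (e i j)%:R | i <- enum 'I_n, j <- enum 'I_n].

(* the drawing P (as a row-major list of its coordinates) *)
Definition drawing_output (n d : nat) (P : 'M[R]_(n, d)) : seq C :=
  [seq (P i c)%:C | i <- enum 'I_n, c <- enum 'I_d].

(* some radical computation tree, run on the graph e, outputs the drawing P *)
Definition radical_computable (n d : nat) (e : rel 'I_n) (P : 'M[R]_(n, d))
  : Prop :=
  exists t : rtree, rtree_run (graph_input e) t (drawing_output P).
End RadicalSemantics.

(* Main.v *)
(** Every radical number is fixed by some term G^(n) of the derived series of
   G = Gal(L/Q) for a large enough normal number field L: a commutator of
   automorphisms fixes all roots of unity, and a commutator of automorphisms
   fixing a^k and the k-th roots of unity fixes a.  For the graph below, twice
   the largest eigenvalue of B is a root of
   x^5 - 11 x^4 + 22 x^3 + 80 x^2 - 187 x - 67.  If it were radical, G would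
   act on the five roots as a solvable group, transitive because no proper
   nonempty subset of the roots has integer sum.  By a theorem of Galois such a
   group normalises a 5-cycle c, so it preserves or swaps the sums of r_i r_(c i)
   and of r_i r_(c^2 i), and their product, being rational and integral, is an
   integer.  Approximating the real roots, one sees that none of the six
   possible products is an integer. *)
Require Import Defs.
From HB Require Import structures.
From mathcomp Require Import all_boot all_order all_fingroup all_algebra.
From mathcomp Require Import all_solvable all_field.
From mathcomp Require Import boolp all_reals complex.
From mathcomp Require Import zify ring lra.
Set Implicit Arguments. Unset Strict Implicit. Unset Printing Implicit Defensive.
Import Order.TTheory GRing.Theory Num.Theory.

(** * Solvable permutation groups of prime degree *)

Section PrimeDegree.
Import GroupScope.

(** An element fixing one point [x] commutes with elements of [A] that carry [x] to any other point,
    so it fixes every point. Point stabilisers are therefore trivial and orbit counting gives the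
    order. *)
Lemma abelian_transitive_regular (T : finType) (A : {group {perm T}}) :
  abelian A -> [transitive A, on [set: T] | 'P] -> #|A| = #|T|.
Proof.
move=> abA trA; have [x _ orb_x] := imsetP trA.
rewrite -(card_orbit_stab 'P A x) -orb_x cardsT.
suffices ->: 'C_A[x | 'P] = 1 by rewrite cards1 muln1.
apply/trivgP/subsetP=> a /setIP[Aa /astab1P /= ax].
rewrite inE; apply/eqP/permP=> y; rewrite perm1.
have /orbitP[b Ab <-]: y \in orbit 'P A x by rewrite -orb_x inE.
by rewrite /= /aperm in ax *; rewrite -permM -(centsP abA a Aa b Ab) permM ax.
Qed.

(** Galois's theorem. A minimal normal subgroup [A] of the solvable group [G] is abelian and, by
    primitivity, transitive, hence regular of prime order. The generator [c] of [A] is chosen to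
    send [x] to [y]. *)
Lemma solvable_prime_degree (T : finType) (G : {group {perm T}}) (x y : T) :
    prime #|T| -> [transitive G, on [set: T] | 'P] -> solvable G -> x != y ->
  exists c : {perm T}, [/\ c x = y, #[c] = #|T|,
    uniq (traject c x #|T|) & G \subset 'N(<[c]>)].
Proof.
move=> prT trG solG neq_xy.
(* A point stabiliser has prime index, so it is a maximal subgroup. *)
have primG: [primitive G, on [set: T] | 'P].
  rewrite (trans_prim_astab (in_setT x) trG); apply/orP; right.
  rewrite p_index_maximal ?subsetIl // -card_orbit.
  by rewrite (atransP trG) ?inE // cardsT.
have ntG: G :!=: 1.
  apply: contraNneq neq_xy => G1.
  have [g] := atransP2 trG (in_setT x) (in_setT y).
  by rewrite G1 => /set1P-> ->; rewrite act1.
have [A minA sAG] := minnormal_exists ntG (normG G).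
have [nAG ntA /is_abelemP[p _ /abelem_abelian abA]] :=
  minnormal_solvable minA sAG solG.
have nsAG: A <| G by rewrite /normal sAG.
case: (prim_trans_norm primG nsAG) => [/subsetIP[_ cA] | trA].
  case/negP: ntA; rewrite -subG1; apply: subset_trans cA _.
  by apply/subsetP=> a /astabP cTa; apply/set1P/permP=> z; rewrite perm1 -[RHS](cTa z).
have oA := abelian_transitive_regular abA trA.
have [c Ac xc] := atransP2 trA (in_setT x) (in_setT y).
have nt_c: c != 1 by apply: contraNneq neq_xy => c1; rewrite xc c1 act1.
have oc: #[c] = #|T|.
  apply/eqP; have := order_dvdG Ac; rewrite oA.
  by case/primeP: prT => _ prT /prT; rewrite order_eq1 (negPf nt_c).
have cycA: <[c]> = A by apply/eqP; rewrite eqEcard cycle_subG Ac oA -oc /=.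
exists c; split=> //; last by rewrite cycA.
suffices <-: #|porbit c x| = #|T| by apply: uniq_traject_porbit.
by rewrite porbitE cycA -cardsT; congr #|pred_of_set _|; apply: (atransP trA).
Qed.
End PrimeDegree.

Local Open Scope ring_scope.

(** * Number fields and radicals *)

Section NumberFields.
Variable C : numClosedFieldType.
Local Notation QtoC := (ratr : rat -> C).
Local Notation pQtoC := (map_poly QtoC).
Local Notation algebraic := (algebraicOver QtoC).

Lemma algebraic_seq_root (s : seq C) : {in s, forall z, algebraic z} ->
  exists2 g : {poly rat}, g != 0 & {in s, forall z, root (pQtoC g) z}.
Proof.
elim: s => [|z s IHs] alg_s; first by exists 1; rewrite ?oner_eq0.
have [|g nz_g g_s] := IHs; first by move=> y sy; apply: alg_s; rewrite inE sy orbT.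
have [p nz_p pz0] := alg_s z (mem_head _ _).
exists (p * g) => [|y]; first by rewrite mulf_neq0.
rewrite inE rmorphM rootM => /predU1P[-> | /g_s ->]; last by rewrite orbT.
by rewrite pz0.
Qed.

(** Primitive element theorem, adjoining one number at a time. Writing [z] as a combination of [s]
    with natural coefficients later shows that [s] generates the whole field built from [z]. *)
Lemma algebraic_seq_primitive (s : seq C) : {in s, forall z, algebraic z} ->
  exists z : C, [/\ algebraic z,
     exists a : nat ^ size s, z = \sum_(i < size s) s`_i *+ a i
   & exists ps, s = [seq (pQtoC p).[z] | p <- ps]].
Proof.
elim: s => [|x s IHs] alg_s.
  exists 0; split; [exact: algebraic0 | | by exists nil].
  by exists [ffun _ => 0%N]; rewrite big_ord0.
have [|z [alg_z [a Dz] [ps Ds]]] := IHs.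
  by move=> y sy; apply: alg_s; rewrite inE sy orbT.
have alg_x := alg_s x (mem_head _ _).
have [rx nz_rx rx0] := alg_x.
(* [pchar0_PET] yields a difference; applied to [- z] it gives the sum [x *+ n + z]. *)
have [rz nz_rz rz0] := algebraic_opp alg_z.
have [n [[pz Dpz] [px Dpx]]] := pchar0_PET nz_rz rz0 nz_rx rx0 (pchar_num _).
rewrite opprK in Dpz Dpx.
exists (x *+ n + z); split.
- apply: algebraic_add => //; rewrite -mulr_natl.
  by apply: algebraic_mul => //; rewrite -(ratr_nat C); apply: algebraic_id.
- exists [ffun i => oapp a n (unlift ord0 i)].
  rewrite /= big_ord_recl ffunE unlift_none Dz; congr (_ + _).
  by apply: eq_bigr => i _; rewrite ffunE liftK.
exists (px :: [seq p \Po - pz | p <- ps]); rewrite /= Dpx; congr (_ :: _).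
rewrite -map_comp Ds; apply: eq_map => p /=.
by rewrite map_comp_poly horner_comp raddfN hornerN Dpz opprK.
Qed.

(** All complex roots of one rational polynomial [g] vanishing on [s] are adjoined to the rationals.
    The result is normal because it is a splitting field of [g]. *)
Lemma number_field_exists (s : seq C) : {in s, forall z, algebraic z} ->
  exists (L : splittingFieldType rat) (iota : {rmorphism L -> C}),
    {in s, forall z, exists u, iota u = z}.
Proof.
move=> /algebraic_seq_root[g nz_g g_s].
have [rs Dg] := closed_field_poly_normal (pQtoC g).
have lead_g: lead_coef (pQtoC g) != 0 by rewrite lead_coef_eq0 map_poly_eq0.
have root_rs y : root (pQtoC g) y = (y \in rs).
  by rewrite Dg rootZ // root_prod_XsubC.
have [|z [alg_z [a Dz] [ps Drs]]] := @algebraic_seq_primitive rs.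
  by move=> y; rewrite -root_rs; exists g.
(* The minimal polynomial of [z]; [pselect] supplies the decidability that its construction asks
   for. *)
have [|r [/monic_neq0 nz_r rz0 irr_r]] :=
  @minPoly_decidable_closure rat C ratr z _ (proj1 (integral_algebraic _ _) alg_z).
  by move=> y; apply: pselect.
have [L0 [iota [z1 iota_z1 z1gen]]]:
  exists (L0 : fieldExtType rat) (iota : {rmorphism L0 -> C}),
    exists2 z1 : L0, iota z1 = z & forall x, exists p, fieldExt_horner z1 p = x.
- exists (SubFieldExtType rz0 irr_r), (@subfx_inj _ _ ratr z r).
  exists (subfx_root _ z r) => [|x]; first exact: subfx_inj_root.
  by have [p ->] := subfxEroot rz0 nz_r x; exists p.
pose inL := fieldExt_horner z1; pose s1 := map inL ps.
have iota_in p : iota (inL p) = (pQtoC p).[z].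
  rewrite /inL /= -horner_map iota_z1 -map_poly_comp; congr _.[z].
  by apply: eq_map_poly => b /=; rewrite alg_num_field fmorph_rat.
have iota_s1 : map iota s1 = rs.
  by rewrite Drs /s1 -map_comp; apply: eq_map => p; rewrite -[RHS]iota_in.
have sz_s1 : size s1 = size rs by rewrite -iota_s1 [RHS]size_map.
have gen_s1 : <<1 & s1>>%VS = fullv.
  apply/vspaceP=> x; rewrite memvf; have [p {x}<-] := z1gen x.
  elim/poly_ind: p => [|p b ApQs]; first by rewrite rmorph0 mem0v.
  rewrite rmorphD rmorphM /= fieldExt_hornerX fieldExt_hornerC.
  suffices Dz1: z1 = \sum_(i < size rs) s1`_i *+ a i.
    rewrite memvD ?memvZ ?mem1v ?memvM // Dz1 ?memv_suml // => i _.
    by rewrite rpredMn ?seqv_sub_adjoin ?mem_nth // sz_s1.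
  apply: (fmorph_inj iota); rewrite iota_z1 Dz rmorph_sum; apply: eq_bigr => i _.
  by rewrite rmorphMn /= -(nth_map _ 0) ?sz_s1 ?iota_s1.
have splitL : splitting_field_axiom L0.
  exists (map_poly (in_alg L0) g).
    by apply/polyOverP=> i; rewrite coef_map /= rpredZ ?mem1v.
  exists s1 => //; rewrite -(eqp_map iota) rmorph_prod /=.
  rewrite (eq_bigr _ (fun x _ => map_polyXsubC iota x)).
  rewrite -(big_map iota xpredT (fun y => 'X - y%:P)).
  rewrite iota_s1 -map_poly_comp.
  rewrite (eq_map_poly (_ : _ =1 QtoC)) => [|b] /=.
    by rewrite Dg eqp_scale.
  by rewrite alg_num_field fmorph_rat.
pose L : splittingFieldType rat :=
  HB.pack L0 (FieldExt_isSplittingField.Build rat L0 splitL).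
exists L, iota => y /g_s; rewrite root_rs -iota_s1 => /mapP[u _ ->].
by exists u.
Qed.
End NumberFields.

(** * Radical elements and the derived series of a Galois group *)

Inductive radical (F : fieldType) : F -> Prop :=
  | RadicalInt z : radical z%:~R
  | RadicalSub x y : radical x -> radical y -> radical (x - y)
  | RadicalMul x y : radical x -> radical y -> radical (x * y)
  | RadicalInv x : radical x -> radical x^-1
  | RadicalRoot k x : (0 < k)%N -> radical (x ^+ k) -> radical x.

Lemma radical0 (F : fieldType) : radical (0 : F).
Proof. by rewrite -[0](mulr0z 1); apply: RadicalInt. Qed.

Lemma radicalD (F : fieldType) (x y : F) : radical x -> radical y -> radical (x + y).
Proof.
move=> rx ry; rewrite -[y]opprK -[- y]sub0r; do 2!apply: RadicalSub => //.
exact: radical0.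
Qed.

(** Applied to complex conjugation, this is why [radical] has no constructor for it. *)
Lemma radical_rmorph (F K : fieldType) (f : {rmorphism F -> K}) x :
  radical x -> radical (f x).
Proof.
elim=> {x} [z | x y _ rx _ ry | x y _ rx _ ry | x _ rx | k x k_gt0 _ rx].
- by rewrite rmorph_int; apply: RadicalInt.
- by rewrite rmorphB; apply: RadicalSub.
- by rewrite rmorphM; apply: RadicalMul.
- by rewrite fmorphV; apply: RadicalInv.
- by apply: (RadicalRoot k_gt0); rewrite -rmorphXn.
Qed.

Lemma algebraic_root (F K : fieldType) (f : {rmorphism F -> K}) k x :
  (0 < k)%N -> algebraicOver f (x ^+ k) -> algebraicOver f x.
Proof.
move=> k_gt0 [p nz_p pxk0]; exists (p \Po 'X^k).
  by rewrite comp_poly_eq0 ?size_polyXn.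
by rewrite /root map_comp_poly map_polyXn horner_comp hornerXn.
Qed.

Lemma der_leq (gT : finGroupType) (G : {group gT}) m n :
  (m <= n)%N -> (G^`(n) \subset G^`(m))%g.
Proof.
move/subnK <-; elim: (n - m)%N => // d IHd.
by rewrite addSn (subset_trans (der_subS _ _)).
Qed.

Section GaloisFixed.
Variable L : splittingFieldType rat.
Local Notation gT := (gal_of {:L}).

(** The automorphisms fixing [a] form a subgroup, so it is enough to treat the generating
    commutators, which cancel on [a]. *)
Lemma commutator_fix (H : {group gT}) (a : L) :
    {in H &, forall s t : gT, t (s a) = s (t a)} ->
  {in [~: H, H]%g, forall s : gT, s a = a}.
Proof.
move=> comH; pose F := [set s : gT | s a == a].
have F_group : group_set F.
  apply/group_setP; split=> [|s t]; rewrite !inE ?gal_id // => /eqP sa /eqP ta.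
  by rewrite galM ?memvf ?sa ?ta.
suffices: [~: H, H]%g \subset Group F_group.
  by move=> /subsetP sHF s /sHF; rewrite inE => /eqP.
rewrite gen_subG; apply/subsetP=> _ /imset2P[s t Hs Ht ->]; rewrite inE.
have galK (u : gT) b : u ((u^-1)%g b) = b.
  by rewrite -galM ?memvf // mulVg gal_id.
rewrite commgEl conjgE !galM ?memvf // comH ?groupV //.
by rewrite !galK.
Qed.

(** Every automorphism sends a root of unity to one of its powers, and power maps commute. *)
Lemma commutator_fix_unity_root (H : {group gT}) k (a : L) :
  (0 < k)%N -> a ^+ k = 1 -> {in [~: H, H]%g, forall s : gT, s a = a}.
Proof.
move=> k_gt0 ak1; apply: commutator_fix => s t _ _.
have [m prim_a _] := prim_order_exists k_gt0 ak1.
have pow_a (u : gT) : exists i, u a = a ^+ i.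
  have [|i ->] := prim_rootP prim_a (x := u a); last by exists i.
  by rewrite -rmorphXn (prim_expr_order prim_a) rmorph1.
have [i sa] := pow_a s; have [j ta] := pow_a t.
by rewrite sa ta !rmorphXn /= sa ta -!exprM mulnC.
Qed.

(** An element of [[~: H, H]] multiplies [a] by a [k]-th root of unity. Such roots are fixed by
    [[~: H, H]], so any two of these elements commute on [a]. *)
Lemma commutator_fix_root (H : {group gT}) k (a : L) :
    (0 < k)%N -> {in H, forall s : gT, s (a ^+ k) = a ^+ k} ->
  {in [~: [~: H, H], [~: H, H]]%g, forall s : gT, s a = a}.
Proof.
move=> k_gt0 fix_ak.
have [-> s _ | nz_a] := eqVneq a 0; first by rewrite rmorph0.
apply: commutator_fix.
have twist (s : gT) : s \in [~: H, H]%g -> exists2 z : L, z ^+ k = 1 & s a = z * a.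
  move=> H's; exists (s a / a); last by rewrite divfK.
  have Hs: s \in H by apply: subsetP H's; rewrite der1_subG.
  by rewrite expr_div_n -rmorphXn /= fix_ak // divff ?expf_neq0.
move=> s t Hs Ht; have [y yk1 sa] := twist s Hs; have [z zk1 ta] := twist t Ht.
rewrite sa ta !rmorphM /= sa ta.
rewrite (commutator_fix_unity_root k_gt0 yk1 Ht).
by rewrite (commutator_fix_unity_root k_gt0 zk1 Hs) mulrCA.
Qed.

End GaloisFixed.

Definition derived_fixed (L : splittingFieldType rat) (u : L) :=
  exists n, {in ('Gal({:L} / 1))^`(n)%g, forall s : gal_of {:L}, s u = u}.

Lemma radical_algebraic (C : numClosedFieldType) (z : C) :
  radical z -> algebraicOver ratr z.
Proof.
elim=> {z} [z | x y _ ax _ ay | x y _ ax _ ay | x _ ax | k x k_gt0 _ ax].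
- by rewrite -(ratr_int C); apply: algebraic_id.
- exact: algebraic_sub.
- exact: algebraic_mul.
- exact: algebraic_inv.
- exact: algebraic_root ax.
Qed.

(** The list [s] collects the numbers obtained by root extraction. Quantifying over every [L] that
    contains them allows both operands of an operation to be realised in the same field. *)
Lemma radical_derived_fixed (C : numClosedFieldType) (z : C) : radical z ->
  exists2 s : seq C, {in s, forall w, algebraicOver ratr w} &
    forall (L : splittingFieldType rat) (iota : {rmorphism L -> C}),
      {in s, forall w, exists u, iota u = w} ->
    exists2 u, iota u = z & derived_fixed u.
Proof.
elim=> {z} [z | x y _ [s als IHs] _ [t alt IHt] | x y _ [s als IHs] _ [t alt IHt]
          | x _ [s als IHs] | k x k_gt0 rx [s als IHs]].
- exists [::] => // L iota _; exists z%:~R; first by rewrite rmorph_int.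
  by exists 0 => s _; rewrite rmorph_int.
- exists (s ++ t) => [w|L iota st_L].
    by rewrite mem_cat => /orP[/als | /alt].
  have [|u <- [m fixu]] := IHs L iota.
    by move=> w sw; apply: st_L; rewrite mem_cat sw.
  have [|v <- [n fixv]] := IHt L iota.
    by move=> w tw; apply: st_L; rewrite mem_cat tw orbT.
  exists (u - v); first by rewrite rmorphB.
  exists (maxn m n) => g Gg; rewrite rmorphB /= fixu ?fixv //; apply: subsetP Gg;
    by rewrite der_leq ?leq_maxl ?leq_maxr.
- exists (s ++ t) => [w|L iota st_L].
    by rewrite mem_cat => /orP[/als | /alt].
  have [|u <- [m fixu]] := IHs L iota.
    by move=> w sw; apply: st_L; rewrite mem_cat sw.
  have [|v <- [n fixv]] := IHt L iota.
    by move=> w tw; apply: st_L; rewrite mem_cat tw orbT.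
  exists (u * v); first by rewrite rmorphM.
  exists (maxn m n) => g Gg; rewrite rmorphM /= fixu ?fixv //; apply: subsetP Gg;
    by rewrite der_leq ?leq_maxl ?leq_maxr.
- exists s => // L iota /IHs[u <- [m fixu]].
  exists u^-1; first by rewrite fmorphV.
  by exists m => g Gg; rewrite fmorphV /= fixu.
- exists (x :: s) => [w|L iota xs_L].
    by rewrite inE => /predU1P[-> | /als //]; apply/(algebraic_root k_gt0)/radical_algebraic.
  have [u xu] := xs_L x (mem_head _ _).
  have [|v xv [m fixv]] := IHs L iota.
    by move=> w sw; apply: xs_L; rewrite inE sw orbT.
  have uv : v = u ^+ k by apply: (fmorph_inj iota); rewrite xv rmorphXn xu.
  (* Two more commutator levels: the first fixes the [k]-th roots of unity, the second fixes [u]. *)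
  exists u => //; exists m.+2; rewrite !dergSn.
  by apply: (commutator_fix_root k_gt0); rewrite -uv.
Qed.

(** * The Galois action on the roots of a quintic *)

(** If [g] sends [x] to [y], a conjugate of [h] by [g] lies in [H] and fixes [x], so [h] fixes
    [y]. *)
Lemma normal_fix_point (T : finType) (G H : {group {perm T}}) x :
  [transitive G, on [set: T] | 'P] -> (H <| G)%g ->
  {in H, forall h : {perm T}, h x = x} -> H :=: 1%g.
Proof.
move=> trG nsHG fixH; apply/trivgP/subsetP=> h Hh; rewrite inE; apply/eqP/permP=> y.
have [g Gg ->] := atransP2 trG (in_setT x) (in_setT y).
rewrite /= /aperm perm1 -permM.
have -> : (g * h = h ^ g^-1 * g)%g by rewrite conjgE invgK -!mulgA mulVg mulg1.
rewrite permM fixH //; by rewrite memJ_norm // groupV (subsetP (normal_norm nsHG)).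
Qed.

Lemma integral_rat_int (q : rat) :
  integralOver (intr : int -> rat) q -> exists z : int, q = z%:~R.
Proof.
case=> p mon_p; rewrite -(fmorph_root (@ratr algC)) -map_poly_comp => pq0.
have /intrP[z Dz]: (ratr q : algC) \in Num.int.
  apply: Cint_rat_Aint; first exact: Crat_rat.
  apply: root_monic_Aint pq0 _ _; first exact: monic_map.
  by apply/polyOverP=> i; rewrite coef_map /= ratr_int intr_int.
by exists z; apply: (fmorph_inj (@ratr algC)); rewrite /= Dz ratr_int.
Qed.

(** By the Galois correspondence [u] is rational, and a rational algebraic integer is an integer. *)
Lemma galois_fixed_int (L : splittingFieldType rat) (u : L) :
    integralOver (intr : int -> L) u ->
    {in 'Gal({:L} / 1)%g, forall s : gal_of {:L}, s u = u} ->
  exists z : int, u = z%:~R.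
Proof.
move=> int_u fix_u.
have galL : galois 1 {:L}.
  rewrite /galois sub1v normalFieldf andbT.
  by apply/separableP=> v _; apply: pcharf0_separable => p; rewrite pchar_lalg pchar_num.
have: u \in fixedField 'Gal({:L} / 1)%g.
  by apply/fixedFieldP; rewrite ?memvf.
rewrite (galois_fixedField galL) => /vlineP[q Du].
have [|z Dz] := @integral_rat_int q.
  case: int_u => p mon_p; rewrite Du -in_algE => pu0; exists p => //.
  rewrite -(fmorph_root (in_alg L)) -map_poly_comp; congr (is_true (root _ _)): pu0.
  by apply: eq_map_poly => a /=; rewrite -in_algE rmorph_int.
by exists z; rewrite Du Dz -in_algE rmorph_int.
Qed.

Lemma galois_root_perm (L : splittingFieldType rat) (f : {poly int})
    (T : finType) (x : T -> L) :
    map_poly intr f = \prod_i ('X - (x i)%:P) -> injective x ->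
  exists pi : gal_of {:L} -> {perm T}, forall s i, x (pi s i) = s (x i).
Proof.
move=> Df inj_x.
have root_x y : root (map_poly intr f) y -> exists i, x i = y.
  rewrite Df -(big_map x xpredT (fun z => 'X - z%:P)) root_prod_XsubC.
  by case/mapP=> i _ ->; exists i.
have /choice[pi Dpi] (s : gal_of {:L}) :
    exists p : {perm T}, forall i, x (p i) = s (x i).
  have /fin_all_exists[p Dp] i : exists j, x j = s (x i).
    apply: root_x; have: root (map_poly intr f) (x i).
      by rewrite Df /root horner_prod (bigD1 i) //= hornerXsubC subrr mul0r.
    rewrite -(fmorph_root s) -map_poly_comp; congr (is_true (root _ _)).
    by apply: eq_map_poly => a /=; rewrite rmorph_int.
  have inj_p : injective p.
    by move=> i j eq_p; apply/inj_x/(fmorph_inj s); rewrite /= -!Dp eq_p.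
  by exists (perm inj_p) => i; rewrite permE.
by exists pi.
Qed.

(* When [T] has five elements and [c] is a 5-cycle, the sum over the edges of the
   pentagon drawn by [c]; [c ^+ 2] draws the complementary pentagram. *)
Definition pentagon (R : pzSemiRingType) (T : finType) (x : T -> R) (c : {perm T}) :=
  \sum_i x i * x (c i).

Lemma pentagonV (R : comPzSemiRingType) (T : finType) (x : T -> R) (c : {perm T}) :
  pentagon x c^-1 = pentagon x c.
Proof.
rewrite /pentagon (reindex_inj (@perm_inj _ c)) /=.
by apply: eq_bigr => i _; rewrite permK mulrC.
Qed.

(* [c ^ g] is a power of [c]: the powers +-1 fix both sums and +-2 exchange them. *)
Lemma pentagon_prod_norm (R : comPzSemiRingType) (T : finType) (x : T -> R)
    (c g : {perm T}) :
    #[c]%g = 5%N -> (c ^ g \in <[c]>)%g ->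
  pentagon x (c ^ g)%g * pentagon x (c ^+ 2 ^ g)%g = pentagon x c * pentagon x (c ^+ 2)%g.
Proof.
move=> oc /cyclePmin[k lt_k5 Dcg]; rewrite conjXg Dcg -expgM.
have c5 : (c ^+ 5 = 1)%g by rewrite -oc expg_order.
have c4 : (c ^+ 4 = c^-1)%g by apply/eqP; rewrite eq_sym eq_invg_mul -expgS c5.
have c3 : (c ^+ 3 = (c ^+ 2)^-1)%g by apply/eqP; rewrite eq_sym eq_invg_mul -expgD c5.
have c6 : (c ^+ 6 = c)%g by rewrite expgS c5 mulg1.
have c8 : (c ^+ 8 = c ^+ 3)%g by rewrite (expgD c 5 3) c5 mul1g.
rewrite oc in lt_k5; case: k lt_k5 Dcg => [|[|[|[|[|k]]]]] // _ Dcg.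
- have: #[c ^ g]%g = 5%N by rewrite orderJ.
  by rewrite Dcg order1.
- by rewrite c4 pentagonV mulrC.
- by rewrite c6 c3 pentagonV mulrC.
- by rewrite c8 c4 c3 !pentagonV.
Qed.

(** The hypothesis on subset sums stands in for irreducibility: the sum over a Galois orbit of roots
    is invariant and integral, hence an integer, so the orbit is everything. The pair [a], [b]
    normalises the choice of generator of the cyclic group of order 5. *)
Lemma radical_quintic (C : numClosedFieldType) (f : {poly int})
    (T : finType) (r : T -> C) (i a b : T) :
    f \is monic -> map_poly intr f = \prod_i ('X - (r i)%:P) -> injective r ->
    #|T| = 5%N -> a != b ->
    (forall (A : {set T}) (z : int), A != set0 -> A != setT ->
       \sum_(j in A) r j != z%:~R) ->
    radical (r i) ->
  exists2 c : {perm T}, [/\ c a = b, #[c]%g = 5%N & uniq (traject c a 5)] &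
    exists z : int, pentagon r c * pentagon r (c ^+ 2)%g = z%:~R.
Proof.
move=> mon_f Df inj_r cardT neq_ab no_sum rad_ri.
have int_r j : integralOver (intr : int -> C) (r j).
  exists f => //.
  by rewrite Df /root horner_prod (bigD1 j) //= hornerXsubC subrr mul0r.
have alg_r j : algebraicOver ratr (r j).
  have [p mon_p pr0] := int_r j; exists (map_poly intr p).
    by rewrite monic_neq0 ?monic_map.
  rewrite -map_poly_comp; congr (is_true (root _ _)): pr0.
  by apply: eq_map_poly => z /=; rewrite ratr_int.
have [s alg_s fix_ri] := radical_derived_fixed rad_ri.
(* [L] contains both the numbers needed to realise the radical and all the roots. *)
have [|L [iota in_L]] := @number_field_exists C (s ++ codom r).
  by move=> z; rewrite mem_cat => /orP[/alg_s // | /codomP[j ->]].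
have [|u Du [n fix_u]] := fix_ri L iota.
  by move=> w sw; apply: in_L; rewrite mem_cat sw.
have /fin_all_exists[x Dx] j : exists y, iota y = r j.
  by apply: in_L; rewrite mem_cat codom_f orbT.
have inj_x : injective x by move=> j k eq_x; apply: inj_r; rewrite -!Dx eq_x.
have Dfx : map_poly intr f = \prod_i ('X - (x i)%:P).
  apply: (map_inj_poly (fmorph_inj iota) (rmorph0 iota)).
  rewrite -map_poly_comp rmorph_prod.
  rewrite (eq_map_poly (_ : _ =1 intr)) => [|z]; last by rewrite /= rmorph_int.
  by rewrite Df; apply: eq_bigr => j _; rewrite /= map_polyXsubC Dx.
have int_x j : integralOver (intr : int -> L) (x j).
  exists f => //.
  by rewrite Dfx /root horner_prod (bigD1 j) //= hornerXsubC subrr mul0r.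
have [pi Dpi] := galois_root_perm Dfx inj_x.
have piM : {in 'Gal({:L} / 1)%g &, {morph pi : g h / (g * h)%g}}.
  move=> g h _ _; apply/permP=> j; apply: inj_x.
  by rewrite permM !Dpi galM ?memvf.
pose phi := Morphism piM.
pose G := (phi @* 'Gal({:L} / 1))%G.
have fix_int (y : L) : integralOver (intr : int -> L) y ->
    {in 'Gal({:L} / 1)%g, forall g : gal_of {:L}, g y = y} ->
    exists z : int, iota y = z%:~R.
  by move=> int_y /(galois_fixed_int int_y)[z ->]; exists z; rewrite rmorph_int.
have G_pi g : (g \in 'Gal({:L} / 1) -> pi g \in G)%g.
  by move=> Gg; apply: (mem_morphim phi).
have trG : [transitive G, on [set: T] | 'P].
  apply/imsetP; exists i => //; apply/esym/eqP.
  apply: contraT => proper_O; set O := orbit _ _ _ in proper_O.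
  have [||z Dz] := fix_int (\sum_(j in O) x j).
  - by apply: (big_ind _ (integral0 _)) => // y z; apply: integral_add.
  - move=> g Gg; rewrite rmorph_sum [RHS](reindex_inj (@perm_inj _ (pi g))) /=.
    apply: eq_big => [j | j _]; last by rewrite Dpi.
    have actsO : [acts G, on O | 'P] by apply: acts_orbit; apply: subsetT.
    exact: esym (acts_act actsO (G_pi g Gg) j).
  have nzO : O != set0 by apply/set0Pn; exists i; rewrite /O orbit_refl.
  case/negP: (no_sum O z nzO proper_O).
  by rewrite -Dz rmorph_sum; apply/eqP/eq_bigr => j _; rewrite Dx.
have Dxi : x i = u by apply: (fmorph_inj iota); rewrite Dx.
have solG : solvable G.
  (* The derived term that fixes the radical root is normal in the transitive group [G], hence
     trivial. *)
  apply/derivedP; exists n; apply: (normal_fix_point (x := i) trG (der_normal n G)).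
  rewrite /= -(morphim_der phi) // => _ /morphimP[g Gg Gng ->].
  by apply: inj_x; rewrite Dpi Dxi fix_u.
have [|c [cab oc uniq_c nGc]] := solvable_prime_degree _ trG solG neq_ab.
  by rewrite cardT.
rewrite cardT in oc uniq_c.
exists c => //.
have [||z Dz] := fix_int (pentagon x c * pentagon x (c ^+ 2)%g).
- apply: integral_mul; (apply: (big_ind _ (integral0 _)) => [y z | j _];
    [exact: integral_add | exact: integral_mul]).
- move=> g Gg.
  have pentJ d : g (pentagon x d) = pentagon x (d ^ pi g)%g.
    rewrite rmorph_sum [RHS](reindex_inj (@perm_inj _ (pi g))) /=.
    by apply: eq_bigr => j _; rewrite rmorphM /= permJ !Dpi.
  rewrite rmorphM /= !pentJ pentagon_prod_norm //.
  have /subsetP/(_ _ (G_pi g Gg)) := nGc.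
  by move=> /memJ_norm->; apply: cycle_id.
exists z; rewrite -Dz rmorphM !rmorph_sum /=.
by congr (_ * _); apply: eq_bigr => j _; rewrite rmorphM /= !Dx.
Qed.

(** * Numerical approximation of the roots *)

(** Constant term first. Its roots include the doubles of the nonzero eigenvalues of [B]; the
    doubling makes the coefficients integers. *)
Definition quintic : {poly int} := Poly [:: - 67; - 187; 80; 22; - 11; 1].

Lemma polyseq_quintic : quintic = [:: - 67; - 187; 80; 22; - 11; 1] :> seq int.
Proof. by rewrite (PolyK (c := 0)). Qed.

Lemma horner_quintic (R : comNzRingType) (x : R) :
  (map_poly intr quintic).[x] =
  x ^+ 5 - 11 * x ^+ 4 + 22 * x ^+ 3 + 80 * x ^+ 2 - 187 * x - 67.
Proof.
rewrite map_polyE polyseq_quintic horner_Poly /=.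
ring.
Qed.

Lemma monic_quintic : quintic \is monic.
Proof. by rewrite monicE lead_coefE polyseq_quintic. Qed.

Definition root_intervals (R : realType) (x : nat -> R) :=
  [/\ - 2540021%:R / 1000000%:R <= x 0%N <= - 2540020%:R / 1000000%:R,
      - 319164%:R / 1000000%:R <= x 1%N <= - 319163%:R / 1000000%:R,
      2674458%:R / 1000000%:R <= x 2 <= 2674459%:R / 1000000%:R,
      4982168%:R / 1000000%:R <= x 3 <= 4982169%:R / 1000000%:R
    & 6202555%:R / 1000000%:R <= x 4 <= 6202556%:R / 1000000%:R ].

(** The quintic changes sign, alternately upwards and downwards, on five disjoint intervals. Five
    distinct roots exhaust a monic polynomial of degree 5. *)
Lemma quintic_real_roots (R : realType) : exists x : nat -> R,
  map_poly intr quintic = \prod_(i < 5) ('X - (x i)%:P) /\ root_intervals x.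
Proof.
pose f : {poly R} := map_poly intr quintic.
have up (a b : R) : a <= b -> f.[a] <= 0 -> 0 <= f.[b] -> exists2 x, a <= x <= b & root f x.
  by move=> le_ab fa fb; have [|x] := @poly_ivt R f a b le_ab; [rewrite fa fb | exists x].
have down (a b : R) : a <= b -> 0 <= f.[a] -> f.[b] <= 0 -> exists2 x, a <= x <= b & root f x.
  move=> le_ab fa fb; have [|x x_ab] := @poly_ivt R (- f) a b le_ab.
    by rewrite !hornerN oppr_le0 oppr_ge0 fa fb.
  by rewrite rootN; exists x.
have [||| x0 b0 r0] := up (- 2540021%:R / 1000000%:R) (- 2540020%:R / 1000000%:R);
  rewrite ?horner_quintic; try lra.
have [||| x1 b1 r1] := down (- 319164%:R / 1000000%:R) (- 319163%:R / 1000000%:R);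
  rewrite ?horner_quintic; try lra.
have [||| x2 b2 r2] := up (2674458%:R / 1000000%:R) (2674459%:R / 1000000%:R);
  rewrite ?horner_quintic; try lra.
have [||| x3 b3 r3] := down (4982168%:R / 1000000%:R) (4982169%:R / 1000000%:R);
  rewrite ?horner_quintic; try lra.
have [||| x4 b4 r4] := up (6202555%:R / 1000000%:R) (6202556%:R / 1000000%:R);
  rewrite ?horner_quintic; try lra.
exists (nth 0 [:: x0; x1; x2; x3; x4]); split; last exact: And5 b0 b1 b2 b3 b4.
have mon_f : f \is monic by apply/monic_map/monic_quintic.
have size_f : size f = 6%N.
  by rewrite size_map_poly_id0 ?polyseq_quintic // (monicP monic_quintic) oner_neq0.
rewrite -/f [LHS](@all_roots_prod_XsubC _ f [:: x0; x1; x2; x3; x4]) ?size_f //.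
- by rewrite (monicP mon_f) scale1r (big_nth 0) big_mkord.
- by rewrite /= r0 r1 r2 r3 r4.
rewrite uniq_rootsE /= !inE !negb_or -!andbA.
by do ![apply/andP; split]; rewrite // lt_eqF //; lra.
Qed.

(** Here [n - m] is the floor of [t]; two naturals encode an integer of either sign. *)
Lemma not_int_between (R : numDomainType) (t : R) (m n : nat) (z : int) :
  0 < t + m%:R - n%:R < 1 -> t != z%:~R.
Proof.
move=> t01; apply/eqP=> Dt; move: t01; rewrite Dt.
have -> : z%:~R + m%:R - n%:R = (z + m%:Z - n%:Z)%:~R :> R by rewrite intrB intrD.
by rewrite ltr0z ltrz1; lia.
Qed.

Ltac between m n := apply: (@not_int_between _ _ m n); lra.

(** A bilinear function on a rectangle takes its extreme values at the corners. *)
Lemma mul_interval (R : realFieldType) (x y a a' b b' l u : R) :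
    a <= x <= a' -> b <= y <= b' ->
    [/\ l <= a * b <= u, l <= a * b' <= u, l <= a' * b <= u & l <= a' * b' <= u] ->
  l <= x * y <= u.
Proof.
move=> /andP[ax xa] /andP[b_y yb] [/andP[l1 u1] /andP[l2 u2] /andP[l3 u3] /andP[l4 u4]].
have [y0|y0] := lerP 0 y.
  have := ler_wpM2r y0 ax; have := ler_wpM2r y0 xa => xa' ax'.
  have [a0|a0] := lerP 0 a; have [a'0|a'0] := lerP 0 a'; apply/andP; split; nra.
have [a0|a0] := lerP 0 a; have [a'0|a'0] := lerP 0 a'; apply/andP; split; nra.
Qed.

(** The five iterates of [a] exhaust [T], so both sums can be taken along the cycle with indices
    modulo 5. *)
Lemma pentagon_traject (R : comNzRingType) (T : finType) (x : T -> R) (c : {perm T}) (a : T) :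
    #|T| = 5%N -> #[c]%g = 5%N -> uniq (traject c a 5) ->
  let p := x \o (fun k => iter k c a) in
  pentagon x c = p 0%N * p 1%N + p 1%N * p 2 + p 2 * p 3 + p 3 * p 4 + p 4 * p 0%N /\
  pentagon x (c ^+ 2)%g = p 0%N * p 2 + p 1%N * p 3 + p 2 * p 4 + p 3 * p 0%N + p 4 * p 1%N.
Proof.
move=> cardT oc uniq_c p.
have c5 : c (c (c (c (c a)))) = a.
  by rewrite -[RHS](perm1 a) -(expg_order c) oc permX.
have sum_traject (F : T -> R) : \sum_i F i = \sum_(i <- traject c a 5) F i.
  apply: perm_big; apply: uniq_perm => //; first exact: index_enum_uniq.
  move=> y; rewrite mem_index_enum; apply/esym.
  have: #|traject c a 5| = #|T| by rewrite (card_uniqP uniq_c) size_traject cardT.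
  by move/subset_cardP=> full; rewrite (elimT full (subset_predT _)).
rewrite /pentagon !sum_traject /= !big_cons !big_nil /p /= !permX /= !c5.
by split; rewrite addr0 !addrA.
Qed.

Lemma mul_not_int (R : realFieldType) (x y a b : R) (m n : nat) (z : int) :
    a <= x <= a + 2%:R / 10000%:R -> b <= y <= b + 2%:R / 10000%:R ->
    -50 <= a <= 50 -> -50 <= b <= 50 ->
    3 / 100 < a * b + m%:R - n%:R < 97 / 100 ->
  x * y != z%:~R.
Proof.
move=> ax bx a50 b50 ab; apply: (@not_int_between _ _ m n).
(* The error is at most 0.0002 * 50 + 51 * 0.0002 = 0.0204 or less, within the margin 0.03 assumed
   around [a * b]. *)
have : `|x * y - a * b| <= 25 / 1000.
  have -> : x * y - a * b = (x - a) * b + x * (y - b) by ring.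
  apply: le_trans (ler_normD _ _) _; rewrite !normrM.
  have lt1 : `|x - a| <= 2%:R / 10000%:R by rewrite ler_norml; lra.
  have lt2 : `|y - b| <= 2%:R / 10000%:R by rewrite ler_norml; lra.
  have lt3 : `|b| <= 50 by rewrite ler_norml; lra.
  have lt4 : `|x| <= 51 by rewrite ler_norml; lra.
  have := ler_pM (normr_ge0 _) (normr_ge0 _) lt1 lt3.
  have := ler_pM (normr_ge0 _) (normr_ge0 _) lt4 lt2.
  lra.
rewrite ler_norml; lra.
Qed.

Lemma quintic_roots_inj (R : realType) (x : nat -> R) :
  root_intervals x -> injective (fun i : 'I_5 => x i).
Proof.
case=> b0 b1 b2 b3 b4; set r := fun i : 'I_5 => x i.
suffices: {homo r : i j / (i < j)%N >-> i < j}.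
  move=> homo_r i j eq_r; apply/val_inj/eqP.
  by case: ltngtP => // /homo_r; rewrite eq_r ltxx.
move=> [[|[|[|[|[|//]]]]] pi] [[|[|[|[|[|//]]]]] pj] //= _; rewrite /r /=; lra.
Qed.

Lemma quintic_subset_sum (R : realType) (x : nat -> R) (A : {set 'I_5}) (z : int) :
    root_intervals x -> A != set0 -> A != setT ->
  \sum_(j in A) x j != z%:~R.
Proof.
case=> b0 b1 b2 b3 b4 nzA ntA.
have: \sum_(j in A) x j = \sum_(j < 5) (j \in A)%:R * x j.
  by rewrite big_mkcond /=; apply: eq_bigr => j _; case: (j \in A); rewrite ?mul1r ?mul0r.
rewrite !big_ord_recr big_ord0 /= add0r.
set i0 := widen_ord _ _; set i1 := widen_ord _ _; set i2 := widen_ord _ _.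
set i3 := widen_ord _ _; set i4 := ord_max.
have all_i (P : pred 'I_5) : P i0 -> P i1 -> P i2 -> P i3 -> P i4 -> forall i, P i.
  move=> P0 P1 P2 P3 P4 [[|[|[|[|[|//]]]]] pi];
    [move: P0|move: P1|move: P2|move: P3|move: P4]; congr (is_true (P _)); exact: val_inj.
have nzA' : [|| i0 \in A, i1 \in A, i2 \in A, i3 \in A | i4 \in A].
  apply: contraNT nzA; rewrite !negb_or => /and5P[? ? ? ? ?].
  apply/eqP/setP=> i; rewrite inE; apply/negbTE; move: i; exact: all_i.
have ntA' : ~~ [&& i0 \in A, i1 \in A, i2 \in A, i3 \in A & i4 \in A].
  apply: contra ntA => /and5P[? ? ? ? ?].
  apply/eqP/setP=> i; rewrite inE; move: i; exact: all_i.
(* Thirty cases remain, one for each proper nonempty subset. The second argument of [between] minus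
   the first is the floor of the sum. *)
move: nzA' ntA'; clear all_i nzA ntA; do 5!case: (_ \in _) => //=;
  move=> _ _ ->; rewrite ?mul1r ?mul0r;
  [between 0%N 4%N | between 0%N 6%N | between 1%N 0%N | between 0%N 8%N
  | between 0%N 2%N | between 0%N 3%N | between 3%N 0%N | between 0%N 11%N
  | between 0%N 5%N | between 0%N 6%N | between 0%N 0%N | between 0%N 8%N
  | between 0%N 2%N | between 0%N 3%N | between 3%N 0%N | between 0%N 13%N
  | between 0%N 7%N | between 0%N 8%N | between 0%N 2%N | between 0%N 10%N
  | between 0%N 4%N | between 0%N 5%N | between 1%N 0%N | between 0%N 13%N
  | between 0%N 7%N | between 0%N 8%N | between 0%N 2%N | between 0%N 11%N
  | between 0%N 4%N | between 0%N 6%N].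
Qed.

(** Once the ten pairwise products are bounded, the pentagon sums are linear in them and [lra] can
    estimate them. *)
Lemma quintic_root_products (R : realType) (x : nat -> R) : root_intervals x ->
  [/\ 810664%:R / 1000000%:R <= x 0%N * x 1%N <= 810697%:R / 1000000%:R,
      - 6793195%:R / 1000000%:R <= x 0%N * x 2 <= - 6793162%:R / 1000000%:R,
      - 12654825%:R / 1000000%:R <= x 0%N * x 3 <= - 12654792%:R / 1000000%:R,
      - 15754633%:R / 1000000%:R <= x 0%N * x 4 <= - 15754600%:R / 1000000%:R
    & - 853605%:R / 1000000%:R <= x 1%N * x 2 <= - 853572%:R / 1000000%:R ] /\
  [/\ - 1590141%:R / 1000000%:R <= x 1%N * x 3 <= - 1590108%:R / 1000000%:R,
      - 1979644%:R / 1000000%:R <= x 1%N * x 4 <= - 1979611%:R / 1000000%:R,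
      13324587%:R / 1000000%:R <= x 2 * x 3 <= 13324620%:R / 1000000%:R,
      16588462%:R / 1000000%:R <= x 2 * x 4 <= 16588495%:R / 1000000%:R
    & 30902163%:R / 1000000%:R <= x 3 * x 4 <= 30902196%:R / 1000000%:R ].
Proof.
move=> [b0 b1 b2 b3 b4].
split; split.
- by clear -b0 b1; apply: (mul_interval b0 b1); split; lra.
- by clear -b0 b2; apply: (mul_interval b0 b2); split; lra.
- by clear -b0 b3; apply: (mul_interval b0 b3); split; lra.
- by clear -b0 b4; apply: (mul_interval b0 b4); split; lra.
- by clear -b1 b2; apply: (mul_interval b1 b2); split; lra.
- by clear -b1 b3; apply: (mul_interval b1 b3); split; lra.
- by clear -b1 b4; apply: (mul_interval b1 b4); split; lra.
- by clear -b2 b3; apply: (mul_interval b2 b3); split; lra.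
- by clear -b2 b4; apply: (mul_interval b2 b4); split; lra.
- by clear -b3 b4; apply: (mul_interval b3 b4); split; lra.
Qed.

Lemma quintic_pentagons (R : realType) (x : nat -> R) (i j k : 'I_5) (z : int) :
    root_intervals x -> uniq [:: ord0; lift ord0 ord0; i; j; k] ->
  (x 0%N * x 1%N + x 1%N * x i + x i * x j + x j * x k + x k * x 0%N) *
  (x 0%N * x i + x 1%N * x j + x i * x k + x j * x 0%N + x k * x 1%N) != z%:~R.
Proof.
move=> isol_x.
case: i => [[|[|[|[|[|//]]]]] pi] //=;
case: j => [[|[|[|[|[|//]]]]] pj] //=;
case: k => [[|[|[|[|[|//]]]]] pk] //= _;
have {isol_x} [[m01 m02 m03 m04 m12] [m13 m14 m23 m24 m34]] := quintic_root_products isol_x.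
(* One case for each order in which the cycle visits the last three roots. [a] and [b] are lower
   bounds for the two sums, which add up to 22, the coefficient of [x^3]; [n - m] is the floor of
   their product. *)
- apply: (mul_not_int (a := 2842916%:R / 100000%:R) (b := - 642936%:R / 100000%:R)
    (m := 183%N) (n := 0%N)); lra.
- apply: (mul_not_int (a := 3479284%:R / 100000%:R) (b := - 1279304%:R / 100000%:R)
    (m := 446%N) (n := 0%N)); lra.
- apply: (mul_not_int (a := 1337892%:R / 100000%:R) (b := 862088%:R / 100000%:R)
    (m := 0%N) (n := 115%N)); lra.
- apply: (mul_not_int (a := 3991794%:R / 100000%:R) (b := - 1791814%:R / 100000%:R)
    (m := 716%N) (n := 0%N)); lra.
- apply: (mul_not_int (a := 1608923%:R / 100000%:R) (b := 591057%:R / 100000%:R)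
    (m := 0%N) (n := 95%N)); lra.
- apply: (mul_not_int (a := 3626456%:R / 100000%:R) (b := - 1426476%:R / 100000%:R)
    (m := 518%N) (n := 0%N)); lra.
Qed.

(** * Multidimensional scaling of the graph *)

Lemma rop_step_radical (R : realType) (env : seq R[i]) op v :
  rop_step env op v -> {in env, forall z, radical z} -> radical v.
Proof.
move=> stp rad_env.
have rad_nth i : (i < size env)%N -> radical (nth 0 env i).
  by move=> lt_i; apply/rad_env/mem_nth.
case: stp => [z | i j lti ltj | i j lti ltj | i j lti ltj | i j lti ltj _
             | k i w k_gt0 lti wk | i lti].
- exact: RadicalInt.
- by apply: radicalD; apply: rad_nth.
- by apply: RadicalSub; apply: rad_nth.
- by apply: RadicalMul; apply: rad_nth.
- by apply: RadicalMul; [|apply: RadicalInv]; apply: rad_nth.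
- by apply: (RadicalRoot k_gt0); rewrite wk; apply: rad_nth.
- by apply/radical_rmorph/rad_nth.
Qed.

(** A test only selects a branch; along a single run every new value comes from a computation
    node. *)
Lemma rtree_run_radical (R : realType) (env : seq R[i]) t out :
    rtree_run env t out -> {in env, forall z, radical z} ->
  {in out, forall z, radical z}.
Proof.
elim=> {env t out} [env s s_env | env op v t out stp _ IHt | env i t1 t2 out _ _ _ IHt
                   | env i t1 t2 out _ _ _ IHt] rad_env //; try exact: IHt.
- move=> _ /mapP[i s_i ->]; apply/rad_env/mem_nth; exact: (allP s_env).
- apply: IHt => z; rewrite mem_rcons inE => /predU1P[-> | /rad_env //].
  exact: rop_step_radical stp rad_env.
Qed.

Lemma radical_computable_coord (R : realType) (n d : nat) (e : rel 'I_n)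
    (P : 'M[R]_(n, d)) i c :
  radical_computable e P -> radical ((P i c)%:C)%C.
Proof.
case=> t /rtree_run_radical; apply; last by apply: allpairs_f; rewrite mem_enum.
move=> _ /allpairsP[[j k] [_ _ ->]] /=; case: (e j k); last exact: radical0.
by rewrite -[true%:R](rmorph1 (intr : int -> R[i])); apply: RadicalInt.
Qed.

(* The graph has trivial automorphism group (otherwise the quintic would split)
   and diameter 2, so that squared distances are 0, 1 or 4. *)
Definition asym_edges := [:: (0, 1); (0, 3); (0, 4); (0, 5); (1, 2); (1, 3); (1, 5);
  (2, 3); (2, 4)]%N.

Definition asym_adj (i j : nat) := ((i, j) \in asym_edges) || ((j, i) \in asym_edges).

Definition asym_graph : rel 'I_6 := fun i j => asym_adj i j.

Lemma asym_graph_simple : simple_graph asym_graph.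
Proof.
split=> [x y | x]; first by rewrite /asym_graph /asym_adj orbC.
by case: x => [[|[|[|[|[|[|]]]]]]].
Qed.

Lemma asym_graph_two_steps (i j : 'I_6) : i != j -> ~~ asym_graph i j ->
  exists2 z, asym_graph i z & asym_graph z j.
Proof.
move=> neq_ij nadj.
(* Every pair of distinct nonadjacent vertices has vertex 0 or vertex 1 as a common neighbour. *)
pose z0 : 'I_6 := ord0; pose z1 : 'I_6 := Ordinal (isT : (1 < 6)%N).
have: [&& asym_graph i z0 & asym_graph z0 j] || [&& asym_graph i z1 & asym_graph z1 j]
    || (i == j) || asym_graph i j.
  by case: i j {neq_ij nadj} => [[|[|[|[|[|[|]]]]]]] // ? [[|[|[|[|[|[|]]]]]]].
rewrite (negPf neq_ij) (negPf nadj) !orbF => /orP[] /andP[iz zj];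
  by [exists z0 | exists z1].
Qed.

Lemma asym_graph_connected : connected_graph asym_graph.
Proof.
move=> x y; have [-> // | neq_xy] := eqVneq x y.
have [/connect1 // | nadj] := boolP (asym_graph x y).
have [z xz zy] := asym_graph_two_steps neq_xy nadj.
exact: connect_trans (connect1 xz) (connect1 zy).
Qed.

Lemma gdist_asym_graph (i j : 'I_6) :
  gdist asym_graph i j = (if i == j then 0 else if asym_graph i j then 1 else 2)%N.
Proof.
rewrite /gdist /=; case: eqP => // /eqP neq_ij.
have -> : [exists z, asym_graph i z && (z == j)] = asym_graph i j.
  apply/existsP/idP => [[z /andP[iz /eqP <-]] // | ij].
  by exists j; rewrite ij eqxx.
case: ifPn => // nadj; case: ifPn => // /negP[].
have [z iz zj] := asym_graph_two_steps neq_ij nadj.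
apply/existsP; exists z; rewrite iz; apply/existsP; exists j.
by rewrite zj eqxx.
Qed.

(* With [A] the adjacency matrix, these are the equations [A v = n v + k 1] and
   [1^T v = 0].  The coefficients in the proof come from the adjugate of the
   bordered 7x7 matrix of this system in the unknowns [v0, ..., v5, k]. *)
Lemma asym_eigen_elimination (R : fieldType) (v0 v1 v2 v3 v4 v5 n k : R) :
    2 != 0 :> R ->
    v1 + v3 + v4 + v5 = n * v0 + k -> v0 + v2 + v3 + v5 = n * v1 + k ->
    v1 + v3 + v4 = n * v2 + k -> v0 + v1 + v2 = n * v3 + k ->
    v0 + v2 = n * v4 + k -> v0 + v1 = n * v5 + k ->
    v0 + v1 + v2 + v3 + v4 + v5 = 0 ->
    1 - n - 8 * n ^+ 2 + 2 * n ^+ 3 + 9 * n ^+ 4 + 3 * n ^+ 5 != 0 ->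
  [/\ v0 = 0, v1 = 0 & v2 = 0] /\ [/\ v3 = 0, v4 = 0 & v5 = 0].
Proof.
move=> nz2 eq0 eq1 eq2 eq3 eq4 eq5 eq6; set h := (X in X != 0) => nz_h.
(* The residuals of the equations enter as polynomials, so each formula for [h * v] is an identity
   that [field] verifies; setting the residuals to zero then kills every [v]. *)
pose e0 := v1 + v3 + v4 + v5 - n * v0 - k; pose e1 := v0 + v2 + v3 + v5 - n * v1 - k.
pose e2 := v1 + v3 + v4 - n * v2 - k; pose e3 := v0 + v1 + v2 - n * v3 - k.
pose e4 := v0 + v2 - n * v4 - k; pose e5 := v0 + v1 - n * v5 - k.
pose e6 := v0 + v1 + v2 + v3 + v4 + v5.
have h0 : h * v0 = - ((1 - 6 * n - n ^+ 2 + 10 * n ^+ 3 + 5 * n ^+ 4) * e0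
      + (3 * n - 2 * n ^+ 3 - n ^+ 4) * e1
      + (4 * n - 5 * n ^+ 2 - 7 * n ^+ 3 - n ^+ 4) * e2
      + (2 - 2 * n - n ^+ 2 - n ^+ 3 - n ^+ 4) * e3
      + (- 1 - 2 * n + n ^+ 2 - n ^+ 4) * e4
      + (- 2 + 3 * n + 6 * n ^+ 2 - n ^+ 4) * e5
      + (- 1 + n + 4 * n ^+ 2 - 2 * n ^+ 3 - 4 * n ^+ 4 - n ^+ 5) * e6) / 2 by
    rewrite /h /e0 /e1 /e2 /e3 /e4 /e5 /e6; field.
have h1 : h * v1 = - ((3 * n - 2 * n ^+ 3 - n ^+ 4) * e0
      + (- 4 * n - 3 * n ^+ 2 + 10 * n ^+ 3 + 5 * n ^+ 4) * e1
      + (- 2 * n - n ^+ 3 - n ^+ 4) * e2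
      + (- 2 + 4 * n ^+ 2 - n ^+ 3 - n ^+ 4) * e3
      + (2 + 3 * n - 6 * n ^+ 2 - 6 * n ^+ 3 - n ^+ 4) * e4
      + (5 * n ^+ 2 - n ^+ 4) * e5
      + (n + 3 * n ^+ 2 - 3 * n ^+ 3 - 4 * n ^+ 4 - n ^+ 5) * e6) / 2 by
    rewrite /h /e0 /e1 /e2 /e3 /e4 /e5 /e6; field.
have h2 : h * v2 = - ((4 * n - 5 * n ^+ 2 - 7 * n ^+ 3 - n ^+ 4) * e0
      + (- 2 * n - n ^+ 3 - n ^+ 4) * e1
      + (- 4 * n + 4 * n ^+ 2 + 12 * n ^+ 3 + 5 * n ^+ 4) * e2
      + (- 2 + 2 * n + 4 * n ^+ 2 - n ^+ 4) * e3
      + (2 * n + 5 * n ^+ 2 + n ^+ 3 - n ^+ 4) * e4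
      + (2 - 2 * n - 8 * n ^+ 2 - 5 * n ^+ 3 - n ^+ 4) * e5
      + (3 * n ^+ 2 - 3 * n ^+ 4 - n ^+ 5) * e6) / 2 by
    rewrite /h /e0 /e1 /e2 /e3 /e4 /e5 /e6; field.
have h3 : h * v3 = - ((2 - 2 * n - n ^+ 2 - n ^+ 3 - n ^+ 4) * e0
      + (- 2 + 4 * n ^+ 2 - n ^+ 3 - n ^+ 4) * e1
      + (- 2 + 2 * n + 4 * n ^+ 2 - n ^+ 4) * e2
      + (- 8 * n + 12 * n ^+ 3 + 5 * n ^+ 4) * e3
      + (2 + 4 * n - 3 * n ^+ 2 - 5 * n ^+ 3 - n ^+ 4) * e4
      + (4 * n - 4 * n ^+ 2 - 5 * n ^+ 3 - n ^+ 4) * e5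
      + (2 * n + n ^+ 2 - 2 * n ^+ 3 - 3 * n ^+ 4 - n ^+ 5) * e6) / 2 by
    rewrite /h /e0 /e1 /e2 /e3 /e4 /e5 /e6; field.
have h4 : h * v4 = - ((- 1 - 2 * n + n ^+ 2 - n ^+ 4) * e0
      + (2 + 3 * n - 6 * n ^+ 2 - 6 * n ^+ 3 - n ^+ 4) * e1
      + (2 * n + 5 * n ^+ 2 + n ^+ 3 - n ^+ 4) * e2
      + (2 + 4 * n - 3 * n ^+ 2 - 5 * n ^+ 3 - n ^+ 4) * e3
      + (- 3 - 6 * n + 7 * n ^+ 2 + 14 * n ^+ 3 + 5 * n ^+ 4) * e4
      + (- n - 4 * n ^+ 2 - 4 * n ^+ 3 - n ^+ 4) * e5
      + (- 1 - n + 4 * n ^+ 2 + 2 * n ^+ 3 - 2 * n ^+ 4 - n ^+ 5) * e6) / 2 by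
    rewrite /h /e0 /e1 /e2 /e3 /e4 /e5 /e6; field.
have h5 : h * v5 = - ((- 2 + 3 * n + 6 * n ^+ 2 - n ^+ 4) * e0
      + (5 * n ^+ 2 - n ^+ 4) * e1
      + (2 - 2 * n - 8 * n ^+ 2 - 5 * n ^+ 3 - n ^+ 4) * e2
      + (4 * n - 4 * n ^+ 2 - 5 * n ^+ 3 - n ^+ 4) * e3
      + (- n - 4 * n ^+ 2 - 4 * n ^+ 3 - n ^+ 4) * e4
      + (- 4 * n + 5 * n ^+ 2 + 14 * n ^+ 3 + 5 * n ^+ 4) * e5
      + (- n + n ^+ 2 + n ^+ 3 - 2 * n ^+ 4 - n ^+ 5) * e6) / 2 by
    rewrite /h /e0 /e1 /e2 /e3 /e4 /e5 /e6; field.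
have z0 : e0 = 0 by rewrite /e0 eq0; ring.
have z1 : e1 = 0 by rewrite /e1 eq1; ring.
have z2 : e2 = 0 by rewrite /e2 eq2; ring.
have z3 : e3 = 0 by rewrite /e3 eq3; ring.
have z4 : e4 = 0 by rewrite /e4 eq4; ring.
have z5 : e5 = 0 by rewrite /e5 eq5; ring.
move: h0 h1 h2 h3 h4 h5; rewrite z0 z1 z2 z3 z4 z5 /e6 eq6 !mulr0 !addr0 oppr0 mul0r.
have cancel_h v : h * v = 0 -> v = 0.
  by move/eqP; rewrite mulf_eq0 (negPf nz_h) => /eqP.
by do 6!move/cancel_h=> ->.
Qed.

Lemma center_mxE (R : realType) (u : 'cV[R]_6) i :
  (Defs.center_mx R 6 *m u) i 0 = u i 0 - 6%:R^-1 * \sum_j u j 0.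
Proof.
rewrite mulmxBl mul1mx -scalemxAl !mxE; congr (_ - _ * _).
by apply: eq_bigr => j _; rewrite !mxE mul1r.
Qed.

Lemma center_mx_sum0 (R : realType) (u : 'cV[R]_6) : \sum_i (Defs.center_mx R 6 *m u) i 0 = 0.
Proof.
under eq_bigr do rewrite center_mxE.
by rewrite sumrB sumr_const card_ord; field.
Qed.

Lemma sqdist_asymE (R : realType) (i j : 'I_6) :
  sqdist_mx R asym_graph i j = 4 * (i != j :> nat)%:R - 3 * (asym_adj i j)%:R.
Proof.
rewrite mxE gdist_asym_graph -val_eqE /= /asym_graph; case: eqP => [-> | _] /=.
  by have /negPf := asym_graph_simple.2 j; rewrite /asym_graph => ->; rewrite !mulr0 subr0.
by case: (asym_adj i j); rewrite /=; ring.
Qed.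

(** For [lam != 0] the eigenvector lies in the image of the centering matrix, so its entries sum to
    0 and centering fixes it. The eigenvalue equation then becomes a bordered system in the
    adjacency matrix. *)
Lemma asym_eigenvalue_root (R : realType) (lam : R) (u : 'cV[R]_6) :
    cmds_B R asym_graph *m u = lam *: u -> u != 0 -> lam != 0 ->
  (map_poly intr quintic).[2 * lam] = 0.
Proof.
move=> eig nz_u nz_lam.
pose w := sqdist_mx R asym_graph *m (Defs.center_mx R 6 *m u).
have Bu : lam *: u = (- 2^-1) *: (Defs.center_mx R 6 *m w).
  by rewrite -eig /cmds_B -scalemxAl !mulmxA.
have sum_u : \sum_i u i 0 = 0.
  have: \sum_i (lam *: u) i 0 = 0.
    rewrite Bu; under eq_bigr do rewrite mxE.
    by rewrite -mulr_sumr center_mx_sum0 mulr0.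
  under eq_bigr do rewrite mxE.
  by rewrite -mulr_sumr => /eqP; rewrite mulf_eq0 (negPf nz_lam) => /eqP.
have Ju : Defs.center_mx R 6 *m u = u.
  by apply/colP=> i; rewrite center_mxE sum_u mulr0 subr0.
pose x k : R := u (inord k) 0.
have Dx (i : 'I_6) : u i 0 = x i by rewrite /x inord_val.
pose c := 6%:R^-1 * \sum_i w i 0.
have eqn (i : 'I_6) : \sum_(j < 6) (4 * (i != j :> nat)%:R - 3 * (asym_adj i j)%:R) * x j
    = c - 2 * lam * x i.
  have : (lam *: u) i 0 = ((- 2^-1) *: (Defs.center_mx R 6 *m w)) i 0 by rewrite Bu.
  rewrite mxE Dx [RHS]mxE center_mxE -/c => Dwi.
  have Dw : w i 0 = \sum_(j < 6) (4 * (i != j :> nat)%:R - 3 * (asym_adj i j)%:R) * x j.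
    by rewrite /w Ju mxE; apply: eq_bigr => j _; rewrite sqdist_asymE Dx.
  rewrite -Dw; lra.
have sum_x : x 0%N + x 1%N + x 2 + x 3 + x 4 + x 5 = 0.
  by rewrite -sum_u; under eq_bigr do rewrite Dx; rewrite !big_ord_recr big_ord0 /= add0r.
have eq_k k (lt_k6 : (k < 6)%N) := eqn (Ordinal lt_k6).
have := eq_k 0%N isT; have := eq_k 1%N isT; have := eq_k 2 isT.
have := eq_k 3 isT; have := eq_k 4 isT; have := eq_k 5 isT.
rewrite !big_ord_recr !big_ord0 /= !add0r => eq5 eq4 eq3 eq2 eq1 eq0.
apply/eqP; apply: contraNT nz_u => nz_f.
(* As the entries sum to 0, row [i] reads [- 4 x_i - 3 (A x)_i = c - 2 lam x_i]; solving for
   [(A x)_i] gives the values passed for [n] and [k]. *)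
have [|||||||||[z0 z1 z2] [z3 z4 z5]] := @asym_eigen_elimination R
  (x 0%N) (x 1%N) (x 2) (x 3) (x 4) (x 5)
  ((2 * lam - 4) / 3) (- c / 3);
  [by rewrite pnatr_eq0 | lra | lra | lra | lra | lra | lra | lra | | ].
  (* With [n = (2 lam - 4) / 3], the quintic at [2 lam] is 81 times the polynomial in [n] from the
     elimination. *)
  apply: contraNneq nz_f => h0; rewrite horner_quintic -[0](mulr0 81) -h0.
  by apply/eqP; field.
by apply/eqP/colP=> i; rewrite Dx mxE; case: i => [[|[|[|[|[|[|]]]]]]].
Qed.

(** If the largest eigenvalue were not positive, the quadratic form of [B] would be nonpositive, but
    it equals 1 on the vector [t]. Column 0 of [V] is then an eigenvector for a nonzero
    eigenvalue. *)
Lemma cmds_asym_top_eigen (R : realType) (V : 'M[R]_6) (lam : 'I_6 -> R) :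
    V^T *m V = 1%:M ->
    cmds_B R asym_graph = V *m diag_mx (\row_j lam j) *m V^T ->
    (forall i j : 'I_6, (i <= j)%N -> lam j <= lam i) ->
  0 < lam ord0 /\ (map_poly intr quintic).[2 * lam ord0] = 0.
Proof.
move=> VtV DB sorted_lam.
have lam0 : 0 < lam ord0.
  rewrite ltNge; apply/negP=> lam0.
  (* The difference of two basis vectors is fixed by centering, and the form of [B] on it is the
     squared distance between vertices 0 and 1, which are adjacent. *)
  pose t : 'cV[R]_6 := \col_i ((i == 0%N :> nat)%:R - (i == 1%N :> nat)%:R).
  pose s := sqdist_mx R asym_graph *m t.
  have Jt : Defs.center_mx R 6 *m t = t.
    apply/colP=> i; rewrite center_mxE [X in _ - _ * X](_ : _ = 0) ?mulr0 ?subr0 //.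
    by under eq_bigr do rewrite mxE; rewrite !big_ord_recr big_ord0 /=; ring.
  have Bt i : (cmds_B R asym_graph *m t) i 0 = - 2^-1 * (s i 0 - 6%:R^-1 * \sum_j s j 0).
    by rewrite /cmds_B -scalemxAl -!mulmxA Jt mxE center_mxE.
  have sE (i : 'I_6) : s i 0 = \sum_(j < 6) (4 * (i != j :> nat)%:R - 3 * (asym_adj i j)%:R) *
       ((j == 0%N :> nat)%:R - (j == 1%N :> nat)%:R).
    by rewrite mxE; apply: eq_bigr => j _; rewrite sqdist_asymE mxE.
  have: (t^T *m (cmds_B R asym_graph *m t)) 0 0 = 1.
    rewrite mxE; under eq_bigr do rewrite Bt sE !mxE.
    set S := \sum_j s j 0; clearbody S.
    by rewrite !big_ord_recr !big_ord0 /=; field.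
  rewrite DB -!mulmxA; set y := V^T *m t.
  rewrite mulmxA -[t^T *m V]trmxK trmx_mul trmxK -/y => yBy.
  have: (y^T *m (diag_mx (\row_j lam j) *m y)) 0 0 <= 0.
    rewrite mxE sumr_le0 // => j _; rewrite mul_diag_mx !mxE mulrCA -expr2.
    by rewrite mulr_le0_ge0 ?sqr_ge0 // (le_trans _ lam0) // sorted_lam.
  by rewrite yBy ler10.
split=> //; apply: (@asym_eigenvalue_root _ _ (col ord0 V)).
- rewrite [in LHS]colE mulmxA DB -(mulmxA (V *m _)) VtV mulmx1 -colE mul_mx_diag.
  by apply/colP=> i; rewrite !mxE mulrC.
- apply/eqP=> V0; have /matrixP/(_ ord0 ord0)/eqP := VtV; rewrite !mxE big1 => [|j _].
    by rewrite eq_sym oner_eq0.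
  by have /colP/(_ j) := V0; rewrite !mxE => ->; rewrite mulr0.
- by rewrite gt_eqF.
Qed.

(* There is a (connected, simple) graph on six vertices such that no radical
   computation tree computes its planar classical-MDS drawing. *)
Theorem theorem10 :
  exists e : rel 'I_6,
    simple_graph e /\ connected_graph e /\
    forall (R : realType) (P : 'M[R]_(6, 2)),
      cmds_drawing (isT : (2 <= 6)%N) e P -> ~ radical_computable e P.
Proof.
exists asym_graph; split; first exact: asym_graph_simple.
split=> [|R P [V [lam [VtV DB sorted_lam DP]]] compP]; first exact: asym_graph_connected.
have [lam_gt0 root_lam] := cmds_asym_top_eigen VtV DB sorted_lam.
have [x [Df isol_x]] := quintic_real_roots R.
have [i Di] : exists i : 'I_5, 2 * lam ord0 = x i.
  move/rootP: root_lam; rewrite Df.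
  rewrite -(big_map (fun i : 'I_5 => x i) xpredT (fun y => 'X - y%:P)).
  by rewrite root_prod_XsubC => /mapP[i _ Di]; exists i.
have rad_lam : radical ((lam ord0)%:C)%C.
  (* The drawing reveals the eigenvalue: its first column is a unit vector times
     [Num.sqrt (lam ord0)]. Positivity matters here, since [Num.sqrt] is 0 on negative numbers. *)
  have -> : lam ord0 = \sum_i P i ord0 ^+ 2.
    have sumV : \sum_j V j ord0 ^+ 2 = 1.
      transitivity ((V^T *m V) ord0 ord0); last by rewrite VtV mxE eqxx.
      rewrite mxE; by apply: eq_bigr => j _; rewrite !mxE expr2.
    rewrite -[LHS]mul1r -sumV mulr_suml.
    have w0 : widen_ord (isT : (2 <= 6)%N) ord0 = ord0 by apply: val_inj.
    apply: eq_bigr => j _; rewrite DP !mxE w0 exprMn sqr_sqrtr ?ltW //.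
  rewrite rmorph_sum; apply: big_ind => [|y z|j _]; [exact: radical0|exact: radicalD|].
  by rewrite rmorphXn expr2; apply: RadicalMul; apply: radical_computable_coord compP.
pose r (j : 'I_5) : R[i] := ((x j)%:C)%C.
have rad_ri : radical (r i).
  rewrite /r -Di mulr_natl mulr2n rmorphD; exact: radicalD.
have DfC : map_poly intr quintic = \prod_j ('X - (r j)%:P).
  transitivity (map_poly (real_complex R) (map_poly intr quintic)).
    by rewrite -map_poly_comp; apply: eq_map_poly => z /=; rewrite rmorph_int.
  by rewrite Df rmorph_prod; apply: eq_bigr => j _; rewrite /= map_polyXsubC.
have inj_r : injective r by move=> j k /complexI/(quintic_roots_inj isol_x).
have no_sum (A : {set 'I_5}) (z : int) : A != set0 -> A != setT -> \sum_(j in A) r j != z%:~R.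
  move=> nzA ntA; apply: contra (quintic_subset_sum z isol_x nzA ntA) => /eqP Dz.
  by apply/eqP/complexI; rewrite rmorph_sum rmorph_int.
(* The 5-cycle is normalised to send the smallest root to the second smallest, which leaves six
   cases. *)
have [||c [c01 oc uniq_c] [z Dz]] :=
  radical_quintic (a := ord0) (b := lift ord0 ord0) monic_quintic DfC inj_r _ _ no_sum rad_ri;
  rewrite ?card_ord //.
have [|p1 p2] := pentagon_traject (fun j : 'I_5 => x j) _ oc uniq_c; first exact: card_ord.
(* The integrality obtained over the complex numbers is brought back to the reals, where the
   estimates apply. *)
have : pentagon (fun j : 'I_5 => x j) c * pentagon (fun j : 'I_5 => x j) (c ^+ 2)%g = z%:~R.
  apply: complexI; rewrite [RHS]rmorph_int -Dz rmorphM !rmorph_sum.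
  by congr (_ * _); apply: eq_bigr => j _; rewrite rmorphM.
apply/eqP; rewrite p1 p2 /= c01.
apply: quintic_pentagons => //.
by rewrite /traject c01 in uniq_c.
Qed.
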